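(* Let $\varepsilon\in\mathbb{R}$ satisfy $\varepsilon<-\tfrac{1}{15}$. Then the planar piecewise smooth system $$\dot x = 1-x-k(y)\,x,\qquad \dot y=\beta-\beta\varepsilon-k(y)\,\varepsilon-\alpha-(\beta+k(y))\,y-(\alpha\beta-\alpha)\,x,$$ with $\alpha=\tfrac45$, $\beta=\tfrac12$, $k(y)=1$ for $y>0$ and $k(y)=0$ for $y<0$, with dynamics on the splitting manifold $\{y=0\}$ given by Filippov's convention, has exactly one real equilibrium, this equilibrium is globally stable, and the system has no pseudoequilibria.
   Context: For $\lambda\in[0,1]$ write $f(x,y;\lambda)=\bigl(1-x-\lambda x,\ \beta-\beta\varepsilon-\lambda\varepsilon-\alpha-(\beta+\lambda)y-(\alpha\beta-\alpha)x\bigr)$ with $\alpha=4/5$, $\beta=1/2$; equivalently $f(x,y;\lambda)=\bigl(1-(1+\lambda)x,\ -\tfrac{3}{10}+\tfrac25 x-(\tfrac12+\lambda)(y+\varepsilon)\bigr)$. The system is $(\dot x,\dot y)=f(x,y;k(y))$ for $y\neq 0$. A Filippov solution is an absolutely continuous curve $\gamma(t)=(x(t),y(t))$ with $\dot\gamma(t)\in F(\gamma(t))$ for almost every $t$, where $F(x,y)=\{f(x,y;k(y))\}$ if $y\ne0$ and $F(x,0)=\{f(x,0;\lambda):\lambda\in[0,1]\}$. A zero of $f(\cdot\,;1)$ is a real equilibrium if it lies in $\{y>0\}$, and a zero of $f(\cdot\,;0)$ is a real equilibrium if it lies in $\{y<0\}$; a zero of $f(\cdot\,;1)$ in $\{y<0\}$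 or of $f(\cdot\,;0)$ in $\{y>0\}$ is called virtual. The sliding region is the set of points $(x,0)$ for which the second component of $f(x,0;\lambda)$ vanishes for some $\lambda=\lambda^*(x)\in[0,1]$ (unique since $\varepsilon\neq0$). The sliding flow there is $\dot x=1-x-\lambda^*(x)\,x$, and a pseudoequilibrium is an equilibrium of the sliding flow in the sliding region. ''Globally stable'' means globally asymptotically stable: the equilibrium is Lyapunov stable, and every Filippov solution starting in $\mathbb{R}^2$ converges to it as $t\to+\infty$. *)

(* Defs.v *)
From HB Require Import structures.
From mathcomp Require Import all_boot all_order all_algebra.
From mathcomp Require Import all_classical all_reals all_analysis.

Set Implicit Arguments.
Unset Strict Implicit.
Unset Printing Implicit Defensive.

Import Order.TTheory GRing.Theory Num.Theory.
Import numFieldNormedType.Exports.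

Local Open Scope classical_set_scope.
Local Open Scope ring_scope.

Section AbsoluteContinuity.
Context {R : realType} {V : normedModType R}.

(* Degenerate intervals (s i = t i) are allowed; they contribute nothing. *)
Definition abs_continuous (a b : R) (g : R -> V) : Prop :=
  forall e : R, 0 < e -> exists2 d : R, 0 < d &
    forall (n : nat) (s t : 'I_n -> R),
      (forall i, [/\ a <= s i, s i <= t i & t i <= b]) ->
      trivIset [set: 'I_n] (fun i => `]s i, t i[%classic) ->
      \sum_(i < n) (t i - s i) < d ->
      \sum_(i < n) `|g (t i) - g (s i)| < e.

End AbsoluteContinuity.

Section System.
Context {R : realType}.

Definition alpha : R := 4 / 5.
Definition beta : R := 1 / 2.

Definition field (eps : R) (p : R * R) (lam : R) : R * R :=
  (1 - p.1 - lam * p.1,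
   beta - beta * eps - lam * eps - alpha - (beta + lam) * p.2
     - (alpha * beta - alpha) * p.1).

(* Only used for y != 0; the value at 0 is a dummy. *)
Definition k (y : R) : R := if 0 < y then 1 else 0.

Definition filippov_map (eps : R) (p : R * R) : set (R * R) :=
  if p.2 == 0
  then [set field eps p lam | lam in [set lam : R | 0 <= lam <= 1]]
  else [set field eps p (k p.2)].

(* The curve g, considered on [0, T[ only, with T finite or +oo; absolute
   continuity is required on the compact subintervals of [0, T[. *)
Definition filippov_solution (eps : R) (T : \bar R) (g : R -> R * R) : Prop :=
  [/\ (0 < T)%E,
      (forall b : R, 0 <= b -> (b%:E < T)%E -> abs_continuous 0 b g)
    & {ae (@lebesgue_measure R), forall t : R, 0 < t -> (t%:E < T)%E ->
        derivable g t 1 /\ filippov_map eps (g t) ('D_1 g t)}].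

Definition maximal_solution (eps : R) (T : \bar R) (g : R -> R * R) : Prop :=
  filippov_solution eps T g /\
  forall (T' : \bar R) (g' : R -> R * R), (T < T')%E ->
    (forall t : R, 0 <= t -> (t%:E < T)%E -> g' t = g t) ->
    ~ filippov_solution eps T' g'.

Definition lyapunov_stable (eps : R) (p : R * R) : Prop :=
  forall e : R, 0 < e -> exists2 d : R, 0 < d &
    forall (T : \bar R) (g : R -> R * R), filippov_solution eps T g ->
      `|g 0 - p| < d ->
      forall t : R, 0 <= t -> (t%:E < T)%E -> `|g t - p| < e.

(* Every maximal solution exists for all forward time and converges to p;
   solutions on [0, +oo[ are in particular maximal. *)
Definition globally_attractive (eps : R) (p : R * R) : Prop :=
  forall (T : \bar R) (g : R -> R * R), maximal_solution eps T g ->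
    T = +oo%E /\ g t @[t --> +oo] --> p.

Definition globally_stable (eps : R) (p : R * R) : Prop :=
  lyapunov_stable eps p /\ globally_attractive eps p.

Definition real_equilibrium (eps : R) (p : R * R) : Prop :=
  (field eps p 1 = (0, 0) /\ 0 < p.2) \/ (field eps p 0 = (0, 0) /\ p.2 < 0).

(* lam is the value lambda^*(x); it is unique when eps != 0. The point (x, 0)
   is in the sliding region iff such a lam exists. *)
Definition sliding_lambda (eps x lam : R) : Prop :=
  0 <= lam <= 1 /\ (field eps (x, 0) lam).2 = 0.

Definition sliding_region (eps : R) : set (R * R) :=
  [set p | p.2 = 0 /\ exists lam : R, sliding_lambda eps p.1 lam].

Definition pseudoequilibrium (eps : R) (p : R * R) : Prop :=
  sliding_region eps p /\
  forall lam : R, sliding_lambda eps p.1 lam -> 1 - p.1 - lam * p.1 = 0.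

End System.

(* Main.v *)
Require Import Defs.
From mathcomp Require Import all_boot all_order all_algebra.
From mathcomp Require Import all_classical all_reals all_analysis.
From mathcomp Require Import measurable_realfun.
From mathcomp Require Import ring lra.

Set Implicit Arguments.
Unset Strict Implicit.
Unset Printing Implicit Defensive.

Import Order.TTheory GRing.Theory Num.Theory.
Import numFieldNormedType.Exports.

Local Open Scope ring_scope.

(** Put [d = - eps - 1 / 15 > 0].  The field for [lam = 1] vanishes at
    [(1 / 2, d)], which lies in [y > 0]; the field for [lam = 0] vanishes at
    [(1, d + 4 / 15)], which is virtual.

    Since [eps < 0], the second component of the field on [y = 0] increases
    with [lam], so sliding only takes place where the upper field does not point
    down and the lower field does not point up: the sliding region repels and
    solutions are not unique.  The argument therefore follows no trajectory in
    particular.  It uses a handful of linear functionals [p * x + q * y] whose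
    derivative has a sign for every [lam] that the differential inclusion
    allows:

    - [x] is eventually at least [1 / 2 - d], because below that level it
      increases at a speed bounded away from zero ([eventually_x_ge]);
    - in the strip [1 / 2 - d <= x] the upper field points up near [y = 0], so a
      solution that enters [y > 0] never leaves it again ([solution_y_ge]);
    - in the same strip [x + 6 * y] grows at speed at least [8 / 5 * d] as long
      as [y <= 0], whichever [lam] is taken, while [x] stays bounded; a solution
      cannot remain in [y <= 0] forever ([visits_upper]).

    From then on [lam = 1] and the system is linear with a stable node, whose
    eigencoordinates [x - 1 / 2] and [4 / 5 * (x - 1 / 2) + (y - d)] decay at
    the rates [2] and [3 / 2].  This gives convergence
    ([solution_converges_to_node]) and also Lyapunov stability
    ([node_lyapunov_stable]), since solutions that start near the node remain in
    the strip and in [y > 0].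

    Solutions are only absolutely continuous, so each sign argument rests on
    [ac_nondecreasing]: an absolutely continuous function whose derivative is
    almost everywhere nonnegative is nondecreasing.

    A maximal solution is global because a solution on [0, T[ with [T] finite is
    bounded, hence Lipschitz, hence has a limit at [T], from which it can be
    continued by the flow of one of the two linear fields: because the sliding
    region repels, on [y = 0] either the upper field points strictly up or the
    lower one points strictly down ([local_solution], [solution_extends]). *)

(** * Monotonicity of absolutely continuous functions *)

Section AbsolutelyContinuousFunctions.
Context {R : realType}.
Local Open Scope classical_set_scope.

(** The form of Cousin's lemma used for monotonicity: a transitive relation that
    holds between points on either side of, and close to, any given point holds
    between the endpoints.  The supremum of the points reachable from [a] is
    reachable, and cannot be less than [b]. *)
Lemma local_to_global (P : R -> R -> Prop) (a b : R) : a <= b ->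
  (forall p q r, a <= p -> p <= q -> q <= r -> r <= b ->
    P p q -> P q r -> P p r) ->
  (forall t, a <= t <= b -> exists2 r, 0 < r &
    forall p q, a <= p -> q <= b -> t - r < p <= t -> t <= q < t + r ->
    P p q) ->
  P a b.
Proof.
move=> ab Ptrans Ploc.
pose S := [set s | a <= s <= b /\ P a s]%classic.
have Sa : S a.
  split; first by rewrite lexx.
  have [|r r0 Pr] := Ploc a; first by rewrite lexx.
  by apply: Pr; rewrite ?lexx//; apply/andP; split; lra.
have Sub : has_sup S.
  by split; [exists a|exists b => s [/andP[]]].
set c := sup S.
have ac : a <= c by apply: sup_upper_bound.
have cb : c <= b by apply: ge_sup; [exists a|move=> s [/andP[]]].
have [|r r0 Pr] := Ploc c; first by rewrite ac.
have [s Ss scr] : exists2 s, S s & c - r < s.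
  exact: sup_adherent.
have [/andP[sa sb] Pas] := Ss.
have sc : s <= c by apply: sup_upper_bound.
have Pac : P a c.
  by apply: (Ptrans a s c) => //; apply: Pr => //; apply/andP; split => //; lra.
move: (@sup_upper_bound _ S Sub); rewrite -/c => Sc.
clearbody c.
have [bc|bc] := ltP b (c + r).
  apply: (Ptrans a c b) => //; apply: Pr => //; apply/andP; split => //; lra.
have : S (c + r / 2).
  split; first by apply/andP; split; lra.
  apply: (Ptrans a c) => //; [lra|lra|].
  by apply: Pr => //; [lra|apply/andP; split; lra|apply/andP; split; lra].
by move/Sc; lra.
Qed.

(** The decrease of [h] from [p] to [q] is at most [e * (q - p)], up to the
    oscillation of [h] over finitely many disjoint intervals inside [U].  Here
    [U] will be a small open set containing every time where the derivative is
    not known to be nonnegative, and absolute continuity makes that oscillation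
    small. *)
Definition almost_increasing (U : set R) (e : R) (h : R -> R) (p q : R) :
    Prop :=
  exists n (s t : 'I_n -> R),
    [/\ forall i, [/\ p <= s i, s i <= t i & t i <= q],
        forall i, `]s i, t i[ `<=` U,
        trivIset [set: 'I_n] (fun i => `]s i, t i[) &
        - e * (q - p) - \sum_(i < n) `|h (t i) - h (s i)| <= h q - h p].

Lemma almost_increasing_trans U e h p q r :
  p <= q -> q <= r ->
  almost_increasing U e h p q -> almost_increasing U e h q r ->
  almost_increasing U e h p r.
Proof.
move=> pq qr [n [s [t [st stU triv hst]]]] [n' [s' [t' [st' stU' triv' hst']]]].
exists (n + n')%N,
  (fun i => match fintype.split i with inl j => s j | inr j => s' j end),
  (fun i => match fintype.split i with inl j => t j | inr j => t' j end).
split.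
- move=> i; case: (fintype.split i) => j.
    by have [? ? ?] := st j; split => //; lra.
  by have [? ? ?] := st' j; split => //; lra.
- by move=> i; case: (fintype.split i).
- move=> i j _ _; rewrite -(splitK i) -(splitK j) !unsplitK.
  case: (fintype.split i) => i'; case: (fintype.split j) => j' /=.
  + by move=> /triv ->.
  + move=> [z [/=]]; rewrite !in_itv/= => /andP[_ z1] /andP[z2 _].
    have [_ _ z3] := st i'; have [z4 _ _] := st' j'; exfalso; lra.
  + move=> [z [/=]]; rewrite !in_itv/= => /andP[z2 _] /andP[_ z1].
    have [_ _ z3] := st j'; have [z4 _ _] := st' i'; exfalso; lra.
  + by move=> /triv' ->.
- rewrite big_split_ord/=.
  under eq_bigr do rewrite (unsplitK (inl _)).
  under [X in _ - (_ + X)]eq_bigr do rewrite (unsplitK (inr _)).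
  lra.
Qed.

Lemma disjoint_itv_length n (s t : 'I_n -> R) (U : set R) (d : R) :
  open U -> (lebesgue_measure U < d%:E)%E ->
  (forall i, s i <= t i) -> (forall i, `]s i, t i[ `<=` U) ->
  trivIset [set: 'I_n] (fun i => `]s i, t i[) ->
  \sum_(i < n) (t i - s i) < d.
Proof.
move=> oU Ud st stU triv; rewrite -lte_fin; apply: le_lt_trans Ud.
have mU : measurable U by exact: open_measurable.
rewrite -sumEFin.
have -> : (\sum_(i < n) (t i - s i)%:E =
    \sum_(i < n) lebesgue_measure (`]s i, t i[%classic : set R))%E.
  apply: eq_bigr => i _; rewrite lebesgue_measure_itv/= lte_fin EFinB.
  case: ifPn => //; rewrite -leNgt => ts.
  by rewrite (@le_anti _ _ (s i) (t i)) ?st//= subee.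
rewrite -measure_bigsetU_ord//.
  apply: le_measure; rewrite ?inE//.
    by apply: bigsetU_measurable => i _.
  by apply: (big_ind (fun X => X `<=` U)) => // A B AU BU z [/AU|/BU].
Qed.

(** The two-sided form of the difference quotient estimate, with [t] between [p]
    and [q], is what the local hypothesis of [local_to_global] asks for. *)
Lemma is_derive_ge0_straddle (h : R -> R) (t dh e : R) :
  is_derive t 1 h dh -> 0 <= dh -> 0 < e ->
  exists2 r, 0 < r & forall p q, t - r < p <= t -> t <= q < t + r ->
    - e * (q - p) <= h q - h p.
Proof.
move=> [dbl dhE] dh0 e0.
have hcvg : x^-1 *: ((h \o shift t) (x *: 1) - h t) @[x --> 0^'] --> dh.
  by rewrite -dhE; exact: dbl.
have [r /= r0 hr] : \forall x \near 0^',
    `|dh - x^-1 *: ((h \o shift t) (x *: 1) - h t)| < e.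
  by move/cvgrPdist_lt : hcvg; exact.
have key x : `|x| < r -> - e * `|x| <= (h (x + t) - h t) * Num.sg x.
  move=> xr; have [->|x0] := eqVneq x 0.
    by rewrite add0r normr0 sgr0 !mulr0.
  have := hr x; rewrite /= sub0r normrN => /(_ xr x0).
  rewrite ltr_distl => /andP[_ ]; rewrite /shift/= [x *: 1]mulr1.
  set D := h _ - _ => H.
  have {}H : - e <= x^-1 * D by move: H; rewrite /GRing.scale/=; lra.
  have : - e * `|x| <= x^-1 * D * `|x| by rewrite ler_wpM2r.
  have -> : x^-1 * D * `|x| = D * Num.sg x; last by [].
  by rewrite [`|x|]normrEsg; field.
exists r => // p q /andP[pt tp] /andP[tq qt].
have kp : - e * (t - p) <= h t - h p.
  have := key (p - t); rewrite ler0_norm ?subr_le0// opprB subrK => /(_ _).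
  have [->|pt'] := eqVneq p t; first by rewrite !subrr mulr0.
  rewrite ltr0_sg ?subr_lt0 ?lt_neqAle ?pt'// mulrN1 opprB; apply; lra.
have kq : - e * (q - t) <= h q - h t.
  have := key (q - t); rewrite ger0_norm ?subr_ge0// subrK => /(_ _).
  have [->|qt'] := eqVneq q t; first by rewrite !subrr mulr0.
  rewrite gtr0_sg ?subr_gt0 ?lt_neqAle 1?eq_sym ?qt'// mulr1; apply; lra.
lra.
Qed.

Lemma lebesgue_ae_filter : Filter (almost_everywhere (@lebesgue_measure R)).
Proof. exact: ae_filter_ringOfSetsType. Qed.

Lemma ae_open_cover (Q : R -> Prop) :
  {ae (@lebesgue_measure R), forall t, Q t} ->
  forall d : R, 0 < d -> exists U : set R,
    [/\ open U, forall t, ~ Q t -> U t & (lebesgue_measure U < d%:E)%E].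
Proof.
move=> [N [mN N0 QN]] d d0.
have [|U [oU NU Ud]] := @lebesgue_regularity_outer R N d mN _ d0.
  by move: N0 => /= ->; exact: ltry.
exists U; split => //; first by move=> t nQ; apply: NU; exact: QN.
have -> : U = N `|` (U `\` N) by rewrite setDUK.
have mU : measurable U by exact: open_measurable.
apply: le_lt_trans Ud; apply: (le_trans (measureU2 _ _ _)) => //.
  exact: measurableD.
by rewrite [X in (X + _ <= _)%E]N0 add0e.
Qed.

(** Cover the exceptional times and the endpoints by an open set [U] of measure
    less than [d], where [d] is given by absolute continuity for [e].  Every
    time is then either in [U] or a point of nonnegative derivative, so
    [almost_increasing U e h] holds locally, hence from [a] to [b]; the
    intervals involved have total length less than [d], so [h] decreases by at
    most [e * (b - a) + e]. *)
Lemma ac_nondecreasing (a b : R) (h : R -> R) : a <= b ->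
  abs_continuous a b h ->
  {ae (@lebesgue_measure R), forall t, a < t -> t < b ->
    exists2 dh, is_derive t 1 h dh & 0 <= dh} ->
  h a <= h b.
Proof.
move=> ab hAC hder; apply/ler_addgt0Pr => e' e'0.
(* The total loss is [e * (b - a) + e = e' / 2]. *)
pose e := e' / (b - a + 1) / 2.
have e0 : 0 < e by rewrite /e !divr_gt0//; lra.
have eE : e * (b - a) + e < e'.
  by rewrite -[X in _ + X]mulr1 -mulrDr /e mulrAC divfK; lra.
have [d d0 hd] := hAC e e0.
have : {ae (@lebesgue_measure R), forall t, (a < t -> t < b ->
    exists2 dh, is_derive t 1 h dh & 0 <= dh) /\ t <> a /\ t <> b}.
  have aeN c : {ae (@lebesgue_measure R), forall t, t <> c}.
    exists [set c]; split => //; first exact: lebesgue_measure_set1.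
    by move=> t /= /contrapT.
  by apply: (@filterS3 _ _ lebesgue_ae_filter _ _ _ _ _ hder (aeN a) (aeN b))
    => t ? ? ?.
move=> /ae_open_cover /(_ d d0) [U [oU NU Ud]].
have [n [s [t [st stU triv hst]]]] : almost_increasing U e h a b.
  apply: local_to_global => // [p q r _ pq qr _|t /andP[at_ tb]].
    exact: almost_increasing_trans.
  have [Ut|nUt] := pselect (U t).
    have /= := open_nbhs_nbhs (conj oU Ut) => /nbhs_ballP[r /= r0 rU].
    exists r => // p q ap qb /andP[tp pt] /andP[tq qt].
    exists 1%N, (fun=> p), (fun=> q); split.
    - by move=> _; split => //; lra.
    - move=> _ z /=; rewrite in_itv/= => /andP[pz zq]; apply: rU.
      by rewrite /ball/= ltr_distlC; apply/andP; split; lra.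
    - by move=> i j _ _ _; rewrite !ord1.
    - rewrite big_ord1.
      have := ler_norm (- (h q - h p)); rewrite normrN => H.
      have : 0 <= e * (q - p) by rewrite mulr_ge0//; lra.
      lra.
  have [H [ta tb']] : (a < t -> t < b ->
    exists2 dh, is_derive t 1 h dh & 0 <= dh) /\ t <> a /\ t <> b.
    by apply: contrapT => /NU.
  have [||dh hdh dh0] := H.
  - by rewrite lt_neqAle at_ andbT eq_sym; exact/eqP.
  - by rewrite lt_neqAle tb andbT; exact/eqP.
  have [r r0 hr] := is_derive_ge0_straddle hdh dh0 e0.
  exists r => // p q ap qb pt tq.
  have i0 (T : Type) (i : 'I_0) : T by case: i.
  exists 0%N, (fun=> p), (fun=> q); split.
  - by case.
  - by case.
  - by case.
  - by rewrite big_ord0 subr0 hr.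
have len : \sum_(i < n) (t i - s i) < d.
  by apply: (disjoint_itv_length oU Ud) => // i; have [] := st i.
have := hd n s t st triv len.
lra.
Qed.

Lemma ac_uniform_continuous (a b : R) (V : normedModType R) (g : R -> V) :
  abs_continuous a b g -> forall e, 0 < e -> exists2 d, 0 < d &
  forall p q, a <= p -> p <= q -> q <= b -> q - p < d -> `|g q - g p| < e.
Proof.
move=> gAC e e0; have [d d0 gd] := gAC e e0; exists d => // p q ap pq qb qpd.
have := gd 1%N (fun=> p) (fun=> q); rewrite !big_ord1; apply => //.
by move=> i j _ _ _; rewrite !ord1.
Qed.

Lemma ac_subitv (a b c d : R) (V : normedModType R) (g : R -> V) :
  a <= c -> d <= b -> abs_continuous a b g -> abs_continuous c d g.
Proof.
move=> ac db gAC e e0; have [r r0 gr] := gAC e e0; exists r => // n s t st.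
by apply: gr => i; have [? ? ?] := st i; split => //; lra.
Qed.

(** The sign of the derivative matters only in the band between [c'] and [c]: to
    end up below [c], [h] has to cross this band after the last time where it is
    at least [c], and there it cannot decrease.  Restricting to a band lets the
    barrier be placed inside the region [y > 0], where [lam] is known. *)
Lemma ac_barrier (a b c' c : R) (h : R -> R) : a <= b -> c' < c ->
  abs_continuous a b h ->
  {ae (@lebesgue_measure R), forall t, a < t -> t < b -> c' < h t -> h t < c ->
    exists2 dh, is_derive t 1 h dh & 0 <= dh} ->
  c <= h a -> c <= h b.
Proof.
move=> ab c'c hAC hder ca; rewrite leNgt; apply/negP => hbc.
pose S := [set s | a <= s <= b /\ c <= h s].
have Sa : S a by split => //; rewrite lexx.
have Sub : has_sup S by split; [exists a|exists b => s [/andP[]]].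
have := @sup_upper_bound _ S Sub; have := @sup_adherent _ S.
have : sup S <= b by apply: ge_sup; [exists a|move=> s [/andP[]]].
set m := sup S; clearbody m => mb Sadh Smax.
have am : a <= m by exact: Smax.
have cm : c <= h m.
  apply/ler_addgt0Pr => e e0.
  have [d d0 hd] := ac_uniform_continuous hAC e0.
  have [s Ss ms] := Sadh _ d0 Sub.
  have sm := Smax s Ss; have [/andP[as_ sb] cs] := Ss.
  have : `|h m - h s| < e by apply: hd => //; lra.
  by rewrite ltr_distl => /andP[]; lra.
have {}mb : m < b.
  by rewrite lt_neqAle mb andbT; apply/eqP => mbE; move: cm; rewrite mbE; lra.
have hc t : m < t -> t <= b -> h t < c.
  move=> mt tb; rewrite ltNge; apply/negP => cht.
  suff : t <= m by lra.
  by apply: Smax; split => //; apply/andP; split; lra.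
have c'c0 : 0 < c - c' by rewrite subr_gt0.
have [d d0 hd] := ac_uniform_continuous hAC c'c0.
have [r r0 [rd mrb]] : exists2 r, 0 < r & r < d /\ m + r <= b.
  have bm : 0 < b - m by rewrite subr_gt0.
  have [H|H] := leP (d / 2) (b - m).
    by exists (d / 2); [lra|split; lra].
  by exists (b - m); [|split; lra].
suff : h m <= h (m + r) by have := hc (m + r); lra.
apply: ac_nondecreasing; first by lra.
  exact: ac_subitv hAC.
apply: (@filterS _ _ lebesgue_ae_filter _ _ _ hder) => t ht mt tb; apply: ht.
- lra.
- lra.
- have : `|h t - h m| < c - c' by apply: hd; lra.
  by rewrite ltr_distl => /andP[]; lra.
- by apply: hc; lra.
Qed.

End AbsolutelyContinuousFunctions.

(** * Sign conditions along solutions *)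

Section Solutions.
Context {R : realType}.
Local Open Scope classical_set_scope.

Lemma is_derive_pairP (g : R -> R * R) (t : R) (d : R * R) :
  is_derive t 1 g d <->
  is_derive t 1 (fun s => (g s).1) d.1 /\ is_derive t 1 (fun s => (g s).2) d.2.
Proof.
have drvP (V : normedModType R) (f : R -> V) v : is_derive t 1 f v <->
    x^-1 *: ((f \o shift t) (x *: 1) - f t) @[x --> 0^'] --> v.
  split=> [[dbl <-]|H]; first exact: dbl.
  by split; [apply/cvg_ex; exists v|exact: cvg_lim].
rewrite !drvP; split=> [H|[H1 H2]].
  split; apply/cvgrPdist_lt => e e0; move/cvgrPdist_lt : H => /(_ e e0);
    apply: filterS => x; apply: le_lt_trans;
    rewrite [leRHS]prod_normE /= le_max lexx ?orbT//.
rewrite [d]surjective_pairing.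
exact: (cvg_pair H1 H2).
Qed.

Lemma pair_coord_le (v : R * R) : `|v.1| <= `|v| /\ `|v.2| <= `|v|.
Proof. by rewrite !prod_normE !le_max !lexx orbT. Qed.

(** The term in [rho] turns a lower bound [rho] on a derivative into a sign
    condition, so that barriers also express growth at a given rate. *)
Definition functional (p q rho : R) (g : R -> R * R) (t : R) : R :=
  p * (g t).1 + q * (g t).2 - rho * t.

Lemma ac_functional a b p q rho (g : R -> R * R) :
  abs_continuous a b g -> abs_continuous a b (functional p q rho g).
Proof.
move=> gAC e e0; pose M := `|p| + `|q| + `|rho| + 1.
have M0 : 0 < M by rewrite /M ltr_wpDl// !addr_ge0.
have eM : 0 < e / M / 2 by rewrite !divr_gt0.
have [d d0 gd] := gAC _ eM.
exists (Num.min d (e / M / 2)); first by rewrite lt_min d0.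
move=> n s t st triv; rewrite lt_min => /andP[/(gd n s t st triv) H1 H2].
have key i : `|functional p q rho g (t i) - functional p q rho g (s i)| <=
    M * (`|g (t i) - g (s i)| + (t i - s i)).
  have [_ sti _] := st i.
  have [] := pair_coord_le (g (t i) - g (s i)).
  set w := `|g (t i) - g (s i)|; set u := _.1; set v := _.2 => ul vl.
  have -> : functional p q rho g (t i) - functional p q rho g (s i) =
     p * u + q * v - rho * (t i - s i) by rewrite /functional /u /v /=; ring.
  have H : `|p * u + q * v - rho * (t i - s i)| <=
      `|p| * `|u| + `|q| * `|v| + `|rho| * (t i - s i).
    apply: (le_trans (ler_normB _ _)).
    rewrite [`|rho * _|]normrM (@ger0_norm _ (t i - s i)) ?subr_ge0// lerD2r.
    by apply: (le_trans (ler_normD _ _)); rewrite !normrM.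
  apply: (le_trans H).
  have := normr_ge0 p; have := normr_ge0 q; have := normr_ge0 rho; rewrite /M.
  move=> r0 q0 p0.
  have := ler_wpM2l p0 ul; have := ler_wpM2l q0 vl.
  have : 0 <= (`|rho| + 1) * w by rewrite mulr_ge0 ?normr_ge0//; lra.
  have : 0 <= (`|p| + `|q| + 1) * (t i - s i).
    by rewrite mulr_ge0 ?normr_ge0//; lra.
  lra.
apply: (le_lt_trans (ler_sum _ (fun i _ => key i))).
rewrite -mulr_sumr big_split/= mulrC -ltr_pdivlMr//; lra.
Qed.

Lemma is_derive_functional p q rho (g : R -> R * R) (t : R) (d : R * R) :
  is_derive t 1 g d ->
  is_derive t 1 (functional p q rho g) (p * d.1 + q * d.2 - rho).
Proof.
move=> /is_derive_pairP[d1 d2].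
have := is_deriveB (is_deriveD (is_deriveZ p d1) (is_deriveZ q d2))
  (is_deriveZ rho (is_derive_id t 1)).
by rewrite /GRing.scale /= mulr1.
Qed.

Definition vx (lam x : R) : R := 1 - (1 + lam) * x.
Definition vy (eps lam x y : R) : R :=
  - (3 / 10) + 2 / 5 * x - (1 / 2 + lam) * (y + eps).

Lemma fieldE eps (p : R * R) lam :
  field eps p lam = (vx lam p.1, vy eps lam p.1 p.2).
Proof. by rewrite /field /vx /vy /alpha /beta; congr pair; field. Qed.

Definition admissible (y lam : R) : Prop :=
  [/\ 0 <= lam <= 1, 0 < y -> lam = 1 & y < 0 -> lam = 0].

Lemma filippov_mapP eps (p v : R * R) :
  filippov_map eps p v <->
  exists2 lam, admissible p.2 lam & v = (vx lam p.1, vy eps lam p.1 p.2).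
Proof.
rewrite /filippov_map; case: ifPn => [/eqP y0|y0]; split.
- move=> [lam lam01 <-]; exists lam; last exact: fieldE.
  by split => //; rewrite y0 ltxx.
- by move=> [lam [lam01 _ _] ->]; exists lam => //; rewrite fieldE.
- move=> ->; exists (k p.2); last exact: fieldE.
  rewrite /k; split; case: ifPn => //; rewrite ?lexx ?ler01//.
  by move=> *; lra.
- move=> [lam [lam01 lp ln] ->]; rewrite /k /= fieldE.
  case: ifPn => yp; first by rewrite lp.
  by rewrite ln// lt_neqAle y0 leNgt.
Qed.

Section Trajectory.
Variables (eps : R) (T : \bar R) (g : R -> R * R).
Hypothesis gsol : filippov_solution eps T g.

Lemma solution_barrier_band p q rho c' c a b :
  0 <= a -> a <= b -> (b%:E < T)%E -> c' < c ->
  (forall t lam, a < t -> t < b -> admissible (g t).2 lam ->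
    c' < functional p q rho g t -> functional p q rho g t < c ->
    rho <= p * vx lam (g t).1 + q * vy eps lam (g t).1 (g t).2) ->
  c <= functional p q rho g a -> c <= functional p q rho g b.
Proof.
move=> a0 ab bT c'c H; have [T0 gAC gae] := gsol.
apply: (ac_barrier ab c'c).
  apply: ac_functional; apply: ac_subitv (gAC b _ bT) => //; lra.
apply: (@filterS _ _ lebesgue_ae_filter _ _ _ gae) => t ht at_ tb htc' htc.
have [||dg /filippov_mapP[lam adm dgE]] := ht.
- lra.
- by apply: lt_trans bT; rewrite lte_fin.
have dg' : is_derive t 1 g ('D_1 g t) by split.
exists (p * ('D_1 g t).1 + q * ('D_1 g t).2 - rho).
  exact: is_derive_functional.
by rewrite dgE /= subr_ge0; exact: H.
Qed.

Lemma solution_barrier p q rho c a b : 0 <= a -> a <= b -> (b%:E < T)%E ->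
  (forall t lam, a < t -> t < b -> admissible (g t).2 lam ->
    functional p q rho g t < c ->
    rho <= p * vx lam (g t).1 + q * vy eps lam (g t).1 (g t).2) ->
  c <= functional p q rho g a -> c <= functional p q rho g b.
Proof.
move=> a0 ab bT H; apply: (@solution_barrier_band _ _ _ (c - 1)) => //.
  lra.
by move=> t lam at_ tb adm _; exact: H.
Qed.

Lemma solution_x_ge c a b : 0 <= a -> a <= b -> (b%:E < T)%E -> c <= 1 / 2 ->
  c <= (g a).1 -> c <= (g b).1.
Proof.
move=> a0 ab bT c12 ca.
have := @solution_barrier 1 0 0 c a b a0 ab bT; rewrite /functional.
rewrite !mul1r !mul0r !addr0 !subr0; apply => // t lam _ _ [/andP[l0 l1] _ _].
rewrite mul1r !mul0r addr0 subr0 addr0 /vx => xc.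
have [x0|x0] := leP 0 (g t).1; nra.
Qed.

Lemma solution_x_le c a b : 0 <= a -> a <= b -> (b%:E < T)%E -> 1 <= c ->
  (g a).1 <= c -> (g b).1 <= c.
Proof.
move=> a0 ab bT c1 ca.
have := @solution_barrier (-1) 0 0 (- c) a b a0 ab bT; rewrite /functional.
rewrite !mulN1r !mul0r !addr0 !subr0 !lerN2; apply => // t lam _ _.
move=> [/andP[l0 l1] _ _].
rewrite mulN1r !mul0r addr0 subr0 addr0 /vx; nra.
Qed.

(** At height [y] in [0 < y < c] the only admissible value is [lam = 1], and
    then the vertical speed is at least [11 / 10 * d - 3 / 2 * y], which is
    positive for [y <= 7 / 10 * d]. *)
Lemma solution_y_ge d c a b : eps = - (1 / 15) - d -> 0 < d ->
  0 <= a -> a <= b -> (b%:E < T)%E -> 0 < c <= 7 / 10 * d ->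
  (forall t, a < t -> t < b -> 1 / 2 - d <= (g t).1) ->
  c <= (g a).2 -> c <= (g b).2.
Proof.
move=> epsE d0 a0 ab bT /andP[c0 cd] xd ca.
have := @solution_barrier_band 0 1 0 0 c a b a0 ab bT c0; rewrite /functional.
rewrite !mul1r !mul0r !add0r !subr0; apply => // t lam at_ tb [_ lp _].
rewrite mul1r !mul0r add0r subr0 add0r => y0 yc.
by have := xd t at_ tb; rewrite (lp y0) /vy epsE; lra.
Qed.

End Trajectory.

Section Forever.
Variables (eps : R) (g : R -> R * R).
Hypothesis gsol : filippov_solution eps +oo%E g.

(** Below the level [c] the functional grows at speed at least [sigma], so it
    reaches [c] in finite time; afterwards [c] is a barrier. *)
Lemma eventually_ge p q c sigma t0 : 0 < sigma -> 0 <= t0 ->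
  (forall t lam, t0 < t -> admissible (g t).2 lam ->
    p * (g t).1 + q * (g t).2 < c ->
    sigma <= p * vx lam (g t).1 + q * vy eps lam (g t).1 (g t).2) ->
  exists2 t1, t0 <= t1 & forall t, t1 <= t -> c <= p * (g t).1 + q * (g t).2.
Proof.
move=> s0 t00 H.
have [[t1 t01 ct1]|nex] :=
  pselect (exists2 t1, t0 <= t1 & c <= p * (g t1).1 + q * (g t1).2).
  exists t1 => // t t1t.
  have := @solution_barrier eps _ g gsol p q 0 c t1 t.
  rewrite /functional !mul0r !subr0; apply => //; rewrite ?ltry//; first by lra.
  move=> s lam st1 _ adm; rewrite mul0r subr0 => sc.
  by apply: (le_trans (ltW s0)); apply: H => //; lra.
have {}nex t : t0 <= t -> p * (g t).1 + q * (g t).2 < c.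
  by move=> t0t; rewrite ltNge; apply/negP => ?; apply: nex; exists t.
exfalso.
pose t := t0 + (c - (p * (g t0).1 + q * (g t0).2)) / sigma.
have tt0 : t0 <= t.
  by rewrite /t lerDl divr_ge0 ?(ltW s0)// subr_ge0 ltW ?nex.
have := @solution_barrier eps _ g gsol p q sigma (functional p q sigma g t0)
  t0 t t00 tt0 (ltry _).
have tE : sigma * t = sigma * t0 + (c - (p * (g t0).1 + q * (g t0).2)).
  by rewrite /t; field; exact: lt0r_neq0.
rewrite /functional tE lexx => K.
have : p * (g t0).1 + q * (g t0).2 - sigma * t0 <=
  p * (g t).1 + q * (g t).2 -
    (sigma * t0 + (c - (p * (g t0).1 + q * (g t0).2))).
  apply: K => // s lam st0 _ adm _; apply: H => //; apply: nex; lra.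
by have := nex t tt0; lra.
Qed.

End Forever.
End Solutions.

(** * Stability and attraction of the node *)

Section Node.
Context {R : realType}.
Variables (eps d : R).
Hypothesis epsE : eps = - (1 / 15) - d.
Hypothesis d0 : 0 < d.

(** As long as [y > 0] the system is linear and this eigencoordinate cannot grow
    in absolute value. *)
Lemma node_x_contracts (g : R -> R * R) (T : \bar R) r a b :
  filippov_solution eps T g -> 0 <= a -> a <= b -> (b%:E < T)%E -> 0 <= r ->
  (forall t, a < t -> t < b -> 0 < (g t).2) ->
  `|(g a).1 - 1 / 2| <= r -> `|(g b).1 - 1 / 2| <= r.
Proof.
move=> gsol a0 ab bT r0 yp; rewrite !ler_norml => /andP[H1 H2].
apply/andP; split.
  suff : 1 / 2 - r <= (g b).1 by lra.
  by apply: (solution_x_ge gsol a0 ab bT); lra.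
have := @solution_barrier _ eps _ g gsol (-1) 0 0 (- (1 / 2) - r) a b a0 ab bT.
rewrite /functional !mulN1r !mul0r !addr0 !subr0 => K.
suff : - (1 / 2) - r <= - (g b).1 by lra.
apply: K; last by lra.
move=> t lam at_ tb [_ lp _] xc; rewrite /vx (lp (yp t at_ tb)); lra.
Qed.

(** The second eigencoordinate of the linear system at the node. *)
Lemma node_w_contracts (g : R -> R * R) (T : \bar R) r a b :
  filippov_solution eps T g -> 0 <= a -> a <= b -> (b%:E < T)%E -> 0 <= r ->
  (forall t, a < t -> t < b -> 0 < (g t).2) ->
  `|4 / 5 * ((g a).1 - 1 / 2) + ((g a).2 - d)| <= r ->
  `|4 / 5 * ((g b).1 - 1 / 2) + ((g b).2 - d)| <= r.
Proof.
move=> gsol a0 ab bT r0 yp; rewrite !ler_norml => /andP[H1 H2].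
apply/andP; split.
  have := @solution_barrier _ eps _ g gsol (4 / 5) 1 0 (2 / 5 + d - r)
    a b a0 ab bT.
  rewrite /functional !mul1r !mul0r !subr0 => K.
  suff : 2 / 5 + d - r <= 4 / 5 * (g b).1 + (g b).2 by lra.
  apply: K; last by lra.
  move=> t lam at_ tb [_ lp _]; rewrite /vx /vy (lp (yp t at_ tb)) epsE.
  lra.
have := @solution_barrier _ eps _ g gsol (- (4 / 5)) (-1) 0
  (- (2 / 5 + d + r)) a b a0 ab bT.
rewrite /functional !mulN1r !mul0r !subr0 => K.
suff : - (2 / 5 + d + r) <= - (4 / 5) * (g b).1 - (g b).2 by lra.
apply: K; last by lra.
move=> t lam at_ tb [_ lp _]; rewrite /vx /vy (lp (yp t at_ tb)) epsE.
lra.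
Qed.

(** Starting close enough to the node, [solution_x_ge] and [solution_y_ge] keep
    the solution in [y > 0] for all times whatever [lam] is, so the two
    eigencoordinates control the distance to the node. *)
Lemma node_lyapunov_stable : lyapunov_stable eps (1 / 2, d).
Proof.
move=> e e0.
pose r := Num.min (d / 10) (e / 4).
have r0 : 0 < r by rewrite lt_min !divr_gt0.
have [rd re] : r <= d / 10 /\ r <= e / 4 by rewrite !ge_min !lexx orbT.
clearbody r.
exists r => // T g gsol; rewrite prod_normE /= gt_max => /andP[gx gy] t t0 tT.
have ltT s : s < t -> (s%:E < T)%E.
  by move=> st; apply: lt_trans tT; rewrite lte_fin.
have [gx1 gx2] : 1 / 2 - r < (g 0).1 /\ (g 0).1 < 1 / 2 + r.
  by move: gx; rewrite ltr_distl => /andP[].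
have [gy1 gy2] : d - r < (g 0).2 /\ (g 0).2 < d + r.
  by move: gy; rewrite ltr_distl => /andP[].
have yp s : 0 < s -> s < t -> 0 < (g s).2.
  move=> s0 st; suff : 7 / 10 * d <= (g s).2 by lra.
  apply: (solution_y_ge gsol epsE d0 (lexx 0) (ltW s0) (ltT _ st)).
  - by apply/andP; split; lra.
  - move=> s' s'0 s's; suff : 1 / 2 - r <= (g s').1 by lra.
    apply: (solution_x_ge gsol (lexx 0) (ltW s'0)) => //;
      [by apply: ltT; lra|lra|lra].
  - lra.
have r0' := ltW r0.
have X := node_x_contracts gsol (lexx 0) t0 tT r0' yp (ltW gx).
have r20 : 0 <= 2 * r by lra.
have W : `|4 / 5 * ((g t).1 - 1 / 2) + ((g t).2 - d)| <= 2 * r.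
  apply: (node_w_contracts gsol (lexx 0) t0 tT r20 yp).
  by rewrite ler_norml; apply/andP; split; lra.
rewrite prod_normE /= gt_max.
move: X W; rewrite !ler_norml => /andP[X1 X2] /andP[W1 W2].
by apply/andP; split; rewrite ltr_norml; apply/andP; split; lra.
Qed.

(** To the left of [1 / 2 - d] the horizontal speed [1 - (1 + lam) * x] is at
    least [2 * d] if [0 <= x], and at least [1] if [x < 0]. *)
Lemma eventually_x_ge (g : R -> R * R) : filippov_solution eps +oo%E g ->
  exists2 t1, 0 <= t1 & forall t, t1 <= t -> 1 / 2 - d <= (g t).1.
Proof.
move=> gsol; pose s := Num.min 1 (2 * d).
have s0 : 0 < s by rewrite lt_min ltr01 mulr_gt0.
have [s1 s2] : s <= 1 /\ s <= 2 * d by rewrite !ge_min !lexx orbT.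
clearbody s.
have [t lam _ [/andP[l0 l1] _ _]|t1 t10 H] :=
    @eventually_ge _ eps g gsol 1 0 (1 / 2 - d) s 0 s0 (lexx _).
  rewrite !mul0r !mul1r !addr0 /vx => xc.
  by have [x0|x0] := leP 0 (g t).1; nra.
by exists t1 => // t /H; lra.
Qed.

(** With [eps = - (1 / 15) - d], the derivative of [x + 6 * y] is
    [(1 - lam) / 10 + (7 / 5 - lam) * (x - 1 / 2) + (3 + 6 * lam) * (d - y)].
    The weight [6] makes this at least [8 / 5 * d] for all [lam] in [0, 1] when
    [1 / 2 - d <= x] and [y <= 0].  If [y] stayed nonpositive, [x + 6 * y] would
    tend to infinity although [x] is bounded above. *)
Lemma visits_upper (g : R -> R * R) t1 : filippov_solution eps +oo%E g ->
  0 <= t1 -> (forall t, t1 <= t -> 1 / 2 - d <= (g t).1) ->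
  exists2 t2, t1 <= t2 & 0 < (g t2).2.
Proof.
move=> gsol t10 xd; apply: contrapT => nex.
have yn t : t1 <= t -> (g t).2 <= 0.
  by move=> tt1; rewrite leNgt; apply/negP => ?; apply: nex; exists t.
pose c := Num.max (g t1).1 1.
have [c1 cx] : 1 <= c /\ (g t1).1 <= c by rewrite !le_max !lexx orbT.
clearbody c.
have s0 : 0 < 8 / 5 * d by rewrite mulr_gt0.
have [t lam tt1 [/andP[l0 l1] _ _] _|t2 t12 /(_ t2 (lexx _))] :=
    @eventually_ge _ eps g gsol 1 6 (c + 1) _ t1 s0 t10.
  have := xd t (ltW tt1); have := yn t (ltW tt1).
  rewrite /vx /vy epsE; set x := (g t).1; set y := (g t).2 => y0 x0.
  have : 0 <= (7 / 5 - lam) * (x - (1 / 2 - d)) by rewrite mulr_ge0//; lra.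
  have : 0 <= (1 / 2 + lam) * - y by rewrite mulr_ge0//; lra.
  have : 0 <= lam * d by rewrite mulr_ge0// ltW.
  lra.
have : (g t2).1 <= c by apply: (solution_x_le gsol t10 t12) => //; exact: ltry.
by have := yn t2 t12; lra.
Qed.

(** Once the solution is in [y > 0] for good, both eigencoordinates move towards
    zero at a speed bounded away from zero outside any neighbourhood of zero. *)
Lemma solution_converges_to_node (g : R -> R * R) :
  filippov_solution eps +oo%E g ->
  (g t @[t --> +oo] --> ((1 / 2, d) : R * R))%classic.
Proof.
move=> gsol; have [t1 t10 xd] := eventually_x_ge gsol.
have [t2 t12 y2] := visits_upper gsol t10 xd.
have t20 := le_trans t10 t12.
have yp t : t2 <= t -> 0 < (g t).2.
  move=> t2t; pose c := Num.min (g t2).2 (7 / 10 * d).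
  have c0 : 0 < c by rewrite lt_min y2 mulr_gt0.
  have [c1 c2] : c <= (g t2).2 /\ c <= 7 / 10 * d by rewrite !ge_min !lexx orbT.
  apply: (lt_le_trans c0).
  apply: (solution_y_ge gsol epsE d0 t20 t2t (ltry _)) => //.
    by rewrite c0.
  by move=> s t2s _; apply: xd; lra.
apply/cvgrPdist_le => /= e e0.
have e20 : 0 < e / 2 by rewrite divr_gt0.
have e40 : 0 < e / 4 by rewrite divr_gt0.
have [t lam t2t [_ lp _]|a1 a10 A1] :=
    @eventually_ge _ eps g gsol 1 0 (1 / 2 - e / 2) _ t2 e20 t20.
  by rewrite /vx (lp (yp t (ltW t2t))); lra.
have [t lam t2t [_ lp _]|a2 a20 A2] :=
    @eventually_ge _ eps g gsol (-1) 0 (- (1 / 2) - e / 2) _ t2 e20 t20.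
  by rewrite /vx (lp (yp t (ltW t2t))); lra.
have [t lam t2t [_ lp _]|a3 a30 A3] :=
    @eventually_ge _ eps g gsol (4 / 5) 1 (2 / 5 + d - e / 4) _ t2 e40 t20.
  by rewrite /vx /vy (lp (yp t (ltW t2t))) epsE; lra.
have [t lam t2t [_ lp _]|a4 a40 A4] :=
    @eventually_ge _ eps g gsol (- (4 / 5)) (-1) (- (2 / 5 + d) - e / 4)
      _ t2 e40 t20.
  by rewrite /vx /vy (lp (yp t (ltW t2t))) epsE; lra.
near=> t.
have {}A1 : 1 / 2 - e / 2 <= 1 * (g t).1 + 0 * (g t).2.
  by apply: A1; near: t; apply: nbhs_pinfty_ge; rewrite num_real.
have {}A2 : - (1 / 2) - e / 2 <= -1 * (g t).1 + 0 * (g t).2.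
  by apply: A2; near: t; apply: nbhs_pinfty_ge; rewrite num_real.
have {}A3 : 2 / 5 + d - e / 4 <= 4 / 5 * (g t).1 + 1 * (g t).2.
  by apply: A3; near: t; apply: nbhs_pinfty_ge; rewrite num_real.
have {}A4 : - (2 / 5 + d) - e / 4 <= - (4 / 5) * (g t).1 + -1 * (g t).2.
  by apply: A4; near: t; apply: nbhs_pinfty_ge; rewrite num_real.
rewrite prod_normE /= ge_max.
by apply/andP; split; rewrite ler_norml; apply/andP; split; lra.
Unshelve. all: by end_near. Qed.

End Node.

(** * Continuation of solutions *)

Section Continuation.
Context {R : realType}.
Local Open Scope classical_set_scope.

(** Stated for [s <= t], and up to an end time [T] that is excluded and may be
    infinite, to match the intervals on which solutions live. *)
Definition lipschitz_before (V : normedModType R) (L a : R) (T : \bar R)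
    (g : R -> V) : Prop :=
  forall s t, a <= s -> s <= t -> (t%:E < T)%E -> `|g t - g s| <= L * (t - s).

Lemma lipschitz_ac (V : normedModType R) (L a b : R) (T : \bar R) (g : R -> V) :
  0 <= L -> (b%:E < T)%E -> lipschitz_before L a T g -> abs_continuous a b g.
Proof.
move=> L0 bT gL e e0; have L10 : 0 < L + 1 by lra.
exists (e / (L + 1)); first by rewrite divr_gt0.
move=> n s t st _; rewrite ltr_pdivlMr// => H.
have H0 : 0 <= \sum_(i < n) (t i - s i).
  by apply: sumr_ge0 => i _; have [_ ? _] := st i; rewrite subr_ge0.
apply: (@le_lt_trans _ _ (\sum_(i < n) L * (t i - s i))).
  apply: ler_sum => i _; have [ai sti ti] := st i; apply: gL => //.
  by apply: le_lt_trans bT; rewrite lee_fin.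
by rewrite -mulr_sumr; lra.
Qed.

(** Barriers bound [x] and [y], hence the field; the Lipschitz bound then comes
    from barriers moving at the extreme speeds. *)
Lemma solution_lipschitz eps (T : \bar R) (g : R -> R * R) :
  filippov_solution eps T g -> exists2 L, 0 <= L & lipschitz_before L 0 T g.
Proof.
move=> gsol.
(* For [|x| <= X] the forcing of [y] is at most [X], so the vertical field
   points inwards as soon as [|y + eps|] exceeds [2 * X]. *)
pose X := `|(g 0).1| + 1; pose Y := `|(g 0).2| + `|eps| + 2 * X.
have X1 : 1 <= X by rewrite /X lerDr.
have x0X : `|(g 0).1| <= X by rewrite /X lerDl.
have y0Y : `|(g 0).2| + `|eps| + 2 * X <= Y by [].
clearbody X Y.
have [x0m x0p] : - X <= (g 0).1 /\ (g 0).1 <= X.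
  by apply/andP; rewrite -ler_norml.
have e0 := normr_ge0 eps; have y00 := normr_ge0 (g 0).2.
have [em ep] : - `|eps| <= eps /\ eps <= `|eps|.
  by apply/andP; rewrite -ler_norml.
have [ym yp] : - `|(g 0).2| <= (g 0).2 /\ (g 0).2 <= `|(g 0).2|.
  by apply/andP; rewrite -ler_norml.
have xb t : 0 <= t -> (t%:E < T)%E -> - X <= (g t).1 /\ (g t).1 <= X.
  move=> t0 tT; split; first by apply: (solution_x_ge gsol (lexx 0)) => //; lra.
  exact: (solution_x_le gsol (lexx 0)).
have ltT s t : s < t -> (t%:E < T)%E -> (s%:E < T)%E.
  by move=> st; apply: lt_trans; rewrite lte_fin.
have yb t : 0 <= t -> (t%:E < T)%E -> - Y <= (g t).2 /\ (g t).2 <= Y.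
  move=> t0 tT; split.
    have := @solution_barrier _ eps T g gsol 0 1 0 (- Y) 0 t (lexx _) t0 tT.
    rewrite /functional => K.
    suff : - Y <= 0 * (g t).1 + 1 * (g t).2 - 0 * t by lra.
    apply: K; last by lra.
    move=> s lam s0 st [/andP[l0 l1] _ _] yc.
    have [xm xp] := xb s (ltW s0) (ltT _ _ st tT).
    have : 0 <= (1 / 2 + lam) * (- ((g s).2 + eps) - 2 * X).
      by rewrite mulr_ge0//; lra.
    have : 0 <= lam * X by rewrite mulr_ge0//; lra.
    by rewrite /vy; lra.
  have := @solution_barrier _ eps T g gsol 0 (-1) 0 (- Y) 0 t (lexx _) t0 tT.
  rewrite /functional => K.
  suff : - Y <= 0 * (g t).1 + -1 * (g t).2 - 0 * t by lra.
  apply: K; last by lra.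
  move=> s lam s0 st [/andP[l0 l1] _ _] yc.
  have [xm xp] := xb s (ltW s0) (ltT _ _ st tT).
  have : 0 <= (1 / 2 + lam) * (((g s).2 + eps) - 2 * X).
    by rewrite mulr_ge0//; lra.
  have : 0 <= lam * X by rewrite mulr_ge0//; lra.
  by rewrite /vy; lra.
pose L := 1 + 2 * X + 2 * (Y + `|eps|).
have L0 : 0 <= L by rewrite /L; lra.
exists L => // s t s0 st tT.
have vb u lam : s < u -> u < t -> admissible (g u).2 lam ->
    `|vx lam (g u).1| <= L /\ `|vy eps lam (g u).1 (g u).2| <= L.
  move=> su ut [/andP[l0 l1] _ _].
  have u0 : 0 <= u by lra.
  have uT := ltT _ _ ut tT.
  have [xm xp] := xb u u0 uT; have [ymm ypp] := yb u u0 uT.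
  have : `|(1 + lam) * (g u).1| <= 2 * X.
    rewrite normrM ler_pM// ler_norml; apply/andP; split; lra.
  have : `|(1 / 2 + lam) * ((g u).2 + eps)| <= 2 * (Y + `|eps|).
    rewrite normrM ler_pM// ler_norml; apply/andP; split; lra.
  rewrite /vx /vy /L !ler_norml => /andP[? ?] /andP[? ?].
  by split; apply/andP; split; lra.
have key p q : (forall u lam, s < u -> u < t -> admissible (g u).2 lam ->
      - L <= p * vx lam (g u).1 + q * vy eps lam (g u).1 (g u).2) ->
    - (L * (t - s)) <= p * ((g t).1 - (g s).1) + q * ((g t).2 - (g s).2).
  move=> H.
  have := @solution_barrier _ eps T g gsol p q (- L)
    (functional p q (- L) g s) s t s0 st tT.
  rewrite lexx => K.
  have {}K : functional p q (- L) g s <= functional p q (- L) g t.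
    by apply: K => // u lam su ut adm _; exact: H.
  by move: K; rewrite /functional; lra.
have b u lam : s < u -> u < t -> admissible (g u).2 lam ->
    [/\ - L <= vx lam (g u).1, vx lam (g u).1 <= L,
      - L <= vy eps lam (g u).1 (g u).2 & vy eps lam (g u).1 (g u).2 <= L].
  move=> su ut /(vb u _ su ut)[].
  by rewrite !ler_norml => /andP[? ?] /andP[? ?].
have k1 : - (L * (t - s)) <= 1 * ((g t).1 - (g s).1) + 0 * ((g t).2 - (g s).2).
  by apply: key => u lam su ut /(b u _ su ut)[? ? ? ?]; lra.
have k2 : - (L * (t - s)) <= -1 * ((g t).1 - (g s).1) + 0 * ((g t).2 - (g s).2).
  by apply: key => u lam su ut /(b u _ su ut)[? ? ? ?]; lra.
have k3 : - (L * (t - s)) <= 0 * ((g t).1 - (g s).1) + 1 * ((g t).2 - (g s).2).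
  by apply: key => u lam su ut /(b u _ su ut)[? ? ? ?]; lra.
have k4 : - (L * (t - s)) <= 0 * ((g t).1 - (g s).1) + -1 * ((g t).2 - (g s).2).
  by apply: key => u lam su ut /(b u _ su ut)[? ? ? ?]; lra.
rewrite prod_normE /= ge_max.
by apply/andP; split; rewrite ler_norml; apply/andP; split; lra.
Qed.

(** The functions [h t - L * (T - t)] and [h t + L * (T - t)] enclose the limit,
    the former being nondecreasing; its supremum is the limit. *)
Lemma lipschitz_limit_scalar (L T : R) (h : R -> R) : 0 < T -> 0 <= L ->
  lipschitz_before L 0 T%:E h ->
  exists l, forall t, 0 <= t -> t < T -> `|l - h t| <= L * (T - t).
Proof.
move=> T0 L0 hL.
pose S := [set z | exists2 t, 0 <= t < T & z = h t - L * (T - t)].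
have S0 : S !=set0 by exists (h 0 - L * (T - 0)); exists 0; rewrite // lexx.
have ubS t : 0 <= t -> t < T -> ubound S (h t + L * (T - t)).
  move=> t0 tT _ [s /andP[s0 sT] ->].
  have : 0 <= L * (T - t) by rewrite mulr_ge0//; lra.
  have : 0 <= L * (T - s) by rewrite mulr_ge0//; lra.
  have [st|ts] := leP s t.
    have := hL s t s0 st; rewrite lte_fin => /(_ tT).
    rewrite ler_norml => /andP[].
    lra.
  have := hL t s t0 (ltW ts); rewrite lte_fin => /(_ sT).
  rewrite ler_norml => /andP[].
  lra.
have supS : has_sup S.
  by split => //; exists (h 0 + L * (T - 0)); apply: ubS.
exists (sup S) => t t0 tT; rewrite ler_norml; apply/andP; split.
  have : h t - L * (T - t) <= sup S.
    by apply: sup_upper_bound => //; exists t => //; rewrite t0.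
  lra.
have : sup S <= h t + L * (T - t) by apply: ge_sup => //; exact: ubS.
lra.
Qed.

Lemma lipschitz_limit (L T : R) (g : R -> R * R) : 0 < T -> 0 <= L ->
  lipschitz_before L 0 T%:E g ->
  exists l, forall t, 0 <= t -> t < T -> `|l - g t| <= L * (T - t).
Proof.
move=> T0 L0 gL.
have [l1 H1] : exists l, forall t, 0 <= t -> t < T ->
    `|l - (g t).1| <= L * (T - t).
  apply: lipschitz_limit_scalar => // s t s0 st tT.
  by apply: le_trans (gL s t s0 st tT); have [] := pair_coord_le (g t - g s).
have [l2 H2] : exists l, forall t, 0 <= t -> t < T ->
    `|l - (g t).2| <= L * (T - t).
  apply: lipschitz_limit_scalar => // s t s0 st tT.
  by apply: le_trans (gL s t s0 st tT); have [] := pair_coord_le (g t - g s).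
by exists (l1, l2) => t t0 tT; rewrite prod_normE /= ge_max H1// H2.
Qed.

Definition decay (a T t : R) : R := expR (- a * (t - T)).

Lemma is_derive_decay (a T t : R) :
  is_derive t 1 (decay a T) (- a * decay a T t).
Proof.
rewrite /decay.
have H : is_derive t 1 (fun s => - a * (s - T)) (- a).
  have := is_deriveZ (- a)
    (is_deriveB (is_derive_id t 1) (is_derive_cst T t 1)).
  by rewrite subr0 /GRing.scale /= mulr1.
have := @is_derive1_comp R expR (fun s => - a * (s - T)) t _ _
  (is_derive_expR _) H.
by rewrite mulrC.
Qed.

Lemma decay_lipschitz (a T s t : R) : 0 <= a -> T <= s -> s <= t ->
  `|decay a T t - decay a T s| <= a * (t - s).
Proof.
move=> a0 Ts st.
have as0 : 0 <= a * (s - T) by rewrite mulr_ge0// subr_ge0.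
have at0 : 0 <= a * (t - s) by rewrite mulr_ge0// subr_ge0.
have E : decay a T t = decay a T s * expR (- (a * (t - s))).
  by rewrite /decay -expRD; congr expR; ring.
have D1 : decay a T s <= 1 by rewrite /decay -[leRHS]expR0 ler_expR; lra.
have D0 : 0 <= decay a T s by exact: expR_ge0.
have X1 : expR (- (a * (t - s))) <= 1 by rewrite -[leRHS]expR0 ler_expR; lra.
have X0 : 1 + - (a * (t - s)) <= expR (- (a * (t - s))) by exact: expR_ge1Dx.
rewrite E ler_norml; nra.
Qed.

(** Variation of constants: the eigenvalues [- (1 + lam)] and
    [- (1 / 2 + lam)] are distinct for every [lam], so the solution is a
    combination of the two decays. *)
Lemma linear_flow (eps lam T : R) (z : R * R) : 0 <= lam ->
  exists phi : R -> R * R, [/\ phi T = z,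
    (forall t : R,
       is_derive t 1 phi (vx lam (phi t).1, vy eps lam (phi t).1 (phi t).2)) &
    exists2 L, 0 <= L & lipschitz_before L T +oo%E phi].
Proof.
move=> l0.
pose xs := 1 / (1 + lam); pose b := 1 / 2 + lam.
pose ys := (- (3 / 10) + 2 / 5 * xs) / b - eps.
pose A := z.1 - xs; pose C := - (4 / 5) * A; pose B := z.2 - ys - C.
pose phi t := (xs + A * decay (1 + lam) T t,
  ys + C * decay (1 + lam) T t + B * decay b T t).
have l1 : 1 + lam != 0 by lra.
have b0 : b != 0 by rewrite /b; lra.
exists phi; split.
- rewrite /phi /decay subrr !mulr0 expR0 !mulr1 /B /A [RHS]surjective_pairing.
  by congr pair; ring.
- move=> t; apply/is_derive_pairP; split.
    apply: (is_derive_eq (is_deriveD (is_derive_cst xs t 1)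
      (is_deriveZ A (is_derive_decay (1 + lam) T t)))).
    by rewrite /vx /= /GRing.scale /= /xs; field.
  apply: (is_derive_eq (is_deriveD (is_deriveD (is_derive_cst ys t 1)
    (is_deriveZ C (is_derive_decay (1 + lam) T t)))
    (is_deriveZ B (is_derive_decay b T t)))).
  rewrite /vy /= /GRing.scale /= /ys /C /b /xs; field.
  by apply/andP; split; lra.
- pose L := `|A| * (1 + lam) + `|C| * (1 + lam) + `|B| * b.
  have b00 : 0 <= b by rewrite /b; lra.
  have l10 : 0 <= 1 + lam by lra.
  have L0 : 0 <= L by rewrite /L !addr_ge0// mulr_ge0.
  exists L => // s t Ts st _.
  have D1 := decay_lipschitz l10 Ts st; have D2 := decay_lipschitz b00 Ts st.
  have a1 := ler_wpM2l (normr_ge0 A) D1.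
  have a2 := ler_wpM2l (normr_ge0 C) D1.
  have a3 := ler_wpM2l (normr_ge0 B) D2.
  have n1 : 0 <= `|A| * ((1 + lam) * (t - s)) by rewrite !mulr_ge0// subr_ge0.
  have n2 : 0 <= `|C| * ((1 + lam) * (t - s)) by rewrite !mulr_ge0// subr_ge0.
  have n3 : 0 <= `|B| * (b * (t - s)) by rewrite !mulr_ge0// subr_ge0.
  rewrite prod_normE /= ge_max; apply/andP; split.
    rewrite (_ : _ - _ = A * (decay (1 + lam) T t - decay (1 + lam) T s));
      last by ring.
    by rewrite normrM /L; lra.
  rewrite (_ : _ - _ = C * (decay (1 + lam) T t - decay (1 + lam) T s) +
    B * (decay b T t - decay b T s)); last by ring.
  apply: (le_trans (ler_normD _ _)).
  by rewrite [`|C * _|]normrM [`|B * _|]normrM /L; lra.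
Qed.

(** Off the line [y = 0] the current field is followed.  On it, the vertical
    speeds for [lam = 1] and [lam = 0] differ by [- eps > 0], so either the
    first is positive and the upper flow moves into [y > 0], or the second is
    negative and the lower flow moves into [y < 0]. *)
Lemma local_solution (eps T : R) (z : R * R) : eps < 0 ->
  exists tau (phi : R -> R * R), [/\ 0 < tau, phi T = z,
    (forall t : R, T < t -> t < T + tau ->
       exists2 v, is_derive t 1 phi v & filippov_map eps (phi t) v) &
    exists2 L, 0 <= L & lipschitz_before L T +oo%E phi].
Proof.
move=> eps0.
(* [sg] is the sign of [y] immediately after [T]. *)
have [lam [sg [lam0 hadm hz]]] : exists lam sg : R, [/\ 0 <= lam,
    (forall y, 0 < sg * y -> admissible y lam) &
    0 < sg * z.2 \/ (z.2 = 0 /\ 0 < sg * vy eps lam z.1 z.2)].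
  have up y : 0 < 1 * y -> admissible y 1 by move=> y0; split => //; lra.
  have dn y : 0 < -1 * y -> admissible y 0 by move=> y0; split => //; lra.
  have [y0|y0|y0] := ltgtP z.2 0.
  - by exists 0, (-1); split; [|exact: dn|left; lra].
  - by exists 1, 1; split; [|exact: up|left; lra].
  - have [v0|v0] := ltP 0 (vy eps 1 z.1 0).
      by exists 1, 1; split; [|exact: up|right; rewrite y0; split => //; lra].
    exists 0, (-1); split; [by []|exact: dn|right; rewrite y0; split => //].
    by move: v0; rewrite /vy; lra.
have [phi [phiT dphi [L L0 phiL]]] := linear_flow eps T z lam0.
have [tau tau0 pos] : exists2 tau, 0 < tau &
    forall t, T < t -> t < T + tau -> 0 < sg * (phi t).2.
  case: hz => [sz|[y0 sv]].
    pose M := `|sg| * L + 1.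
    have M0 : 0 < M by rewrite /M ltr_wpDl// mulr_ge0.
    exists (sg * z.2 / M); first by rewrite divr_gt0.
    move=> t Tt; rewrite -ltrBlDl ltr_pdivlMr// => H.
    have := phiL T t (lexx _) (ltW Tt) (ltry _); rewrite phiT => K.
    have {}K := le_trans (proj2 (pair_coord_le (phi t - z))) K.
    have := ler_wpM2l (normr_ge0 sg) K; rewrite -normrM /=.
    have := ler_norm (- (sg * ((phi t).2 - z.2))); rewrite normrN /=.
    have : 0 < t - T by lra.
    move: H; rewrite /M; lra.
  set v := sg * vy _ _ _ _ in sv.
  have v20 : 0 < v / 2 by rewrite divr_gt0.
  have := dphi T; rewrite phiT => /(is_derive_functional 0 sg v) {}D.
  have dh0 : 0 <= 0 * (vx lam z.1, vy eps lam z.1 z.2).1 +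
      sg * (vx lam z.1, vy eps lam z.1 z.2).2 - v.
    by rewrite /= mul0r add0r subrr.
  have [r r0 H] := is_derive_ge0_straddle D dh0 v20.
  exists r => // t Tt tr.
  have := H T t; rewrite /functional phiT y0.
  have -> : T - r < T <= T by apply/andP; split; lra.
  have -> : T <= t < T + r by apply/andP; split; lra.
  move=> /(_ isT isT).
  have : 0 < v * (t - T) by rewrite mulr_gt0// subr_gt0.
  lra.
exists tau, phi; split => //; last by exists L.
move=> t Tt tt.
exists (vx lam (phi t).1, vy eps lam (phi t).1 (phi t).2); first exact: dphi.
by apply/filippov_mapP; exists lam => //; apply: hadm; exact: pos.
Qed.

(** The concatenation is Lipschitz, because both pieces are and they agree at
    [T]; it need not be differentiable at [T], which is a null set. *)
Lemma solution_extends eps (T : R) (g : R -> R * R) : eps < 0 ->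
  filippov_solution eps T%:E g ->
  exists (T' : \bar R) (g' : R -> R * R), [/\ (T%:E < T')%E,
    (forall t, 0 <= t -> (t%:E < T%:E)%E -> g' t = g t) &
    filippov_solution eps T' g'].
Proof.
move=> eps0 gsol; have [T0 gAC gae] := gsol; rewrite lte_fin in T0.
have [L L0 gL] := solution_lipschitz gsol.
have [z zlim] := lipschitz_limit T0 L0 gL.
have [tau [phi [tau0 phiT dphi [M M0 phiM]]]] := local_solution T z eps0.
pose g' t := if t < T then g t else phi t.
exists (T + tau)%:E, g'; split.
- by rewrite lte_fin ltrDl.
- by move=> t t0; rewrite lte_fin /g' => ->.
have KL : L <= L + M by lra.
have KM : M <= L + M by lra.
have K0 : 0 <= L + M by lra.
have g'lip : lipschitz_before (L + M) 0 +oo%E g'.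
  move=> s t s0 st _; rewrite /g'.
  have ts0 : 0 <= t - s by rewrite subr_ge0.
  have [tT|Tt] := ltP t T.
    have sT : s < T by lra.
    rewrite sT; apply: (le_trans (gL s t s0 st _)); first by rewrite lte_fin.
    exact: ler_wpM2r.
  have [sT|Ts] := ltP s T; last first.
    by apply: (le_trans (phiM s t Ts st (ltry _))); exact: ler_wpM2r.
  have := zlim s s0 sT; have := phiM T t (lexx _) Tt (ltry _).
  rewrite phiT => H1 H2.
  rewrite (_ : phi t - g s = (phi t - z) + (z - g s));
    last by rewrite addrA subrK.
  apply: (le_trans (ler_normD _ _)).
  have : 0 <= L * (t - T) by rewrite mulr_ge0// subr_ge0.
  have : 0 <= M * (T - s) by rewrite mulr_ge0// subr_ge0 ltW.
  lra.
split.
- by rewrite lte_fin addr_gt0.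
- by move=> b b0 _; apply: (lipschitz_ac K0 (ltry b) g'lip).
have aeT : {ae (@lebesgue_measure R), forall t, t <> T}.
  exists [set T]; split => //; first exact: lebesgue_measure_set1.
  by move=> t /= /contrapT.
apply: (@filterS2 _ _ lebesgue_ae_filter _ _ _ _ gae aeT) => t ht tT t0.
rewrite lte_fin => tt.
suff [v [D F]] : exists v, is_derive t 1 g' v /\ filippov_map eps (g' t) v.
  by have [? ->] := D.
have [tT'|Tt] := ltP t T.
  have [//|dg F] := ht t0; exists ('D_1 g t); split; last by rewrite /g' tT'.
  have D : is_derive t 1 g ('D_1 g t) by split.
  apply: near_eq_is_derive D.
  near=> s; rewrite /g' ifT//; near: s; exact: lt_nbhsl.
have {}Tt : T < t by rewrite lt_neqAle Tt andbT; apply/eqP => E; apply: tT.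
have [v D F] := dphi t Tt tt.
exists v; split; last by rewrite /g' ltNge (ltW Tt).
apply: near_eq_is_derive D.
near=> s; rewrite /g' ifF//; apply/negbTE; rewrite -leNgt ltW//.
by near: s; exact: lt_nbhsr.
Unshelve. all: by end_near. Qed.

End Continuation.

Unset Implicit Arguments.

Theorem theorem2 (R : realType) (eps : R) (heps : eps < - (1 / 15)) :
  (exists p : R * R,
      [/\ real_equilibrium eps p,
          (forall q : R * R, real_equilibrium eps q -> q = p)
        & globally_stable eps p]) /\
  (forall p : R * R, ~ pseudoequilibrium eps p).
Proof.
pose d := - eps - 1 / 15.
have epsE : eps = - (1 / 15) - d by rewrite /d; ring.
have d0 : 0 < d by rewrite /d; lra.
clearbody d.
split.
  exists (1 / 2, d); split.
  - left; rewrite fieldE /vx /vy epsE; split => //; congr pair => /=; lra.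
  - move=> [x y] [[]|[]]; rewrite fieldE /vx /vy => -[ex ey] /= y0.
      by congr pair; lra.
    by exfalso; lra.
  - split; first exact: node_lyapunov_stable.
    move=> T g [gsol gmax].
    suff TE : T = +oo%E.
      split => //; rewrite TE in gsol.
      exact: (solution_converges_to_node epsE d0 gsol).
    have [T0 _ _] := gsol.
    move: T T0 gsol gmax => [T| |] // T0 gsol gmax; exfalso.
    have [|T' [g' [TT' gg' g'sol]]] := @solution_extends _ eps T g _ gsol.
      by lra.
    exact: (gmax T' g' TT' gg' g'sol).
move=> [x y] [[/= _ [lam sl]] /(_ lam sl) xE]; move: sl xE.
rewrite /sliding_lambda fieldE /vy /= => -[/andP[l0 l1] yE] xE.
(* Eliminating [x] by [(1 + lam) * x = 1], the vertical equation forces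
   [(1 - lam) * (2 - lam) / 15 + (1 + lam) * (1 / 2 + lam) * d = 0]. *)
nra.
Qed.
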